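(* The odd positive integers $n$ and $n+2$ are twin primes if and only if $$\prod_{\substack{p\mid n(n+2)\\ p\text{ odd}}}\left(1-\frac{1}{p^2}\right)^{-1}=\frac{n^2(n+2)^2}{(n-1)(n+1)^2(n+3)}.$$
   Context: Twin primes are pairs of primes whose difference is $2$, so $n$ and $n+2$ are twin primes when both are prime. The product is taken over the odd prime divisors $p$ of $n(n+2)$. *)

(* Defs.v *)
From mathcomp Require Import all_boot all_order all_algebra.
Set Implicit Arguments. Unset Strict Implicit. Unset Printing Implicit Defensive.

Definition twin_primes (p q : nat) : Prop :=
  [/\ prime p, prime q & q = (p + 2)%N].

(* Main.v *)
(** Write [f m] for the product of [1 - 1/p^2] over the primes [p] dividing [m].
    If [m > 1] has a prime factor [p], then [f m <= 1 - 1/p^2 <= 1 - 1/m^2], and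
    equality throughout forces [m = p].  For odd [n] the numbers [n] and [n + 2]
    are coprime, so [f (n (n + 2)) = f n * f (n + 2)], while the inverse of the
    right-hand side is [(1 - 1/n^2) (1 - 1/(n + 2)^2)]; the two products agree
    iff both factors do. *)
Require Import Defs.
From mathcomp Require Import all_boot all_order all_algebra.
From mathcomp Require Import ring.
Import Order.TTheory GRing.Theory Num.Theory.
Local Open Scope ring_scope.

Lemma subr_invsqr_ge0 (R : numFieldType) (m : nat) :
  (0 < m)%N -> 0 <= 1 - 1 / m%:R ^+ 2 :> R.
Proof.
move=> m_gt0; rewrite subr_ge0 div1r invf_le1 ?exprn_gt0 ?ltr0n //.
by rewrite exprn_ege1 // ler1n.
Qed.

Lemma subr_invsqr_gt0 (R : numFieldType) (m : nat) :
  (1 < m)%N -> 0 < 1 - 1 / m%:R ^+ 2 :> R.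
Proof.
move=> m_gt1; rewrite subr_gt0 div1r invf_lt1 ?exprn_gt0 ?ltr0n ?(ltnW m_gt1) //.
by rewrite exprn_egt1 // ltr1n.
Qed.

Lemma ltr_subr_invsqr (R : numFieldType) (p m : nat) :
  (0 < p)%N -> (p < m)%N -> 1 - 1 / p%:R ^+ 2 < 1 - 1 / m%:R ^+ 2 :> R.
Proof.
move=> p_gt0 ltpm; have m_gt0 : (0 < m)%N by apply: ltn_trans ltpm.
rewrite ltrD2l ltrN2 !div1r ltf_pV2 ?posrE ?exprn_gt0 ?ltr0n //.
by rewrite ltrXn2r ?ler0n ?ltr_nat.
Qed.

Lemma prod_primes_gt0 (R : numFieldType) (m : nat) :
  0 < \prod_(p <- primes m) (1 - 1 / p%:R ^+ 2) :> R.
Proof.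
rewrite big_seq; apply: prodr_gt0 => p; rewrite mem_primes => /andP[p_pr _].
by rewrite subr_invsqr_gt0 ?prime_gt1.
Qed.

(** Bundling the bound with its equality case lets the estimates for [n] and [n + 2] be multiplied
    without losing the criterion for equality. *)
Lemma prod_primes_leif (R : numFieldType) (m : nat) : (1 < m)%N ->
  \prod_(p <- primes m) (1 - 1 / p%:R ^+ 2)
    <= (1 - 1 / m%:R ^+ 2 : R) ?= iff prime m.
Proof.
move=> m_gt1; have [m_pr | m_npr] := boolP (prime m).
  by rewrite primes_prime // big_seq1; apply/leif_refl.
have m_gt0 := ltnW m_gt1; have p_pr := pdiv_prime m_gt1.
have p_in : pdiv m \in primes m by rewrite mem_primes p_pr m_gt0 pdiv_dvd.
have ltpm : (pdiv m < m)%N.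
  rewrite ltn_neqAle pdiv_leq // andbT.
  by apply: contraNneq m_npr => <-.
(* For composite [m] the factor at [pdiv m] alone is strictly below the bound; the other factors lie
   in [0, 1]. *)
apply/leifP; rewrite (big_rem _ p_in) /=.
apply: le_lt_trans (ltr_subr_invsqr R _ _ (prime_gt0 p_pr) ltpm).
rewrite ler_piMr ?subr_invsqr_ge0 ?prime_gt0 // big_seq.
apply: prodr_ile1 => q /mem_rem; rewrite mem_primes => /andP[q_pr _].
by rewrite subr_invsqr_ge0 ?prime_gt0 //= gerBl div1r invr_ge0 exprn_ge0.
Qed.

(** Coprimality keeps the concatenation free of repetitions; this splits the product over primes in
    two. *)
Lemma perm_primesM (m n : nat) : (0 < m)%N -> (0 < n)%N -> coprime m n ->
  perm_eq (primes (m * n)) (primes m ++ primes n).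
Proof.
move=> m_gt0 n_gt0 co_mn; apply: uniq_perm => [||p].
- exact: primes_uniq.
- by rewrite cat_uniq !primes_uniq andbT has_sym /= has_sym -coprime_has_primes.
- by rewrite mem_cat primesM.
Qed.

Lemma coprime_odd_add2 (n : nat) : odd n -> coprime n (n + 2).
Proof. by move=> n_odd; rewrite /coprime gcdnDl -/(coprime n 2) coprimen2. Qed.

Theorem corollary3p1 (n : nat) (n_gt0 : (0 < n)%N) (n_odd : odd n) :
  twin_primes n (n + 2) <->
  \prod_(p <- primes (n * (n + 2)) | odd p) (1 - 1 / p%:R ^+ 2)^-1
  = (n%:R ^+ 2 * (n%:R + 2) ^+ 2)
    / ((n%:R - 1) * (n%:R + 1) ^+ 2 * (n%:R + 3)) :> rat.
Proof.
have n2_gt0 : (0 < n + 2)%N by rewrite addn2.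
have n2_gt1 : (1 < n + 2)%N by rewrite addn2 !ltnS.
have -> : \prod_(p <- primes (n * (n + 2)) | odd p) (1 - 1 / p%:R ^+ 2)^-1
  = (\prod_(p <- primes n) (1 - 1 / p%:R ^+ 2)
     * \prod_(p <- primes (n + 2)) (1 - 1 / p%:R ^+ 2))^-1 :> rat.
  rewrite -big_cat -(perm_big _ (perm_primesM _ _ n_gt0 n2_gt0 _)) /=; last first.
    exact: coprime_odd_add2.
  (* All prime divisors of the odd number [n * (n + 2)] are odd, so the filter is vacuous. *)
  rewrite -prodfV big_seq_cond [RHS]big_seq; apply: eq_bigl => p.
  rewrite andb_idr // mem_primes => /and3P[_ _ /dvdn_odd]; apply.
  by rewrite oddM oddD n_odd.
have -> : (n%:R ^+ 2 * (n%:R + 2) ^+ 2)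
    / ((n%:R - 1) * (n%:R + 1) ^+ 2 * (n%:R + 3))
  = ((1 - 1 / n%:R ^+ 2) * (1 - 1 / (n + 2)%:R ^+ 2))^-1 :> rat.
  have n_neq0 : n%:R != 0 :> rat by rewrite pnatr_eq0 -lt0n.
  have n2_neq0 : n%:R + 2 != 0 :> rat by rewrite -natrD pnatr_eq0 -lt0n.
  (* After inversion only [n] and [n + 2] occur in denominators, so the identity also covers
     [n = 1], where [n - 1] vanishes. *)
  rewrite natrD -[LHS]invrK invf_div; congr (_^-1).
  by field; rewrite n_neq0 n2_neq0.
have [n_gt1 | n_le1] := ltnP 1 n; last first.
  (* For [n = 1] the right-hand side is the junk value [0^-1 = 0]. *)
  have n1 : n = 1%N by apply/eqP; rewrite eqn_leq n_le1.
  split=> [[n_pr _ _] | /eqP]; first by rewrite n1 in n_pr.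
  rewrite [in X in _ == X]n1 expr1n divr1 subrr mul0r invr0 invr_eq0.
  by rewrite gt_eqF // mulr_gt0 // prod_primes_gt0.
have [_ eq_iff] := leif_pM
  (ltW (prod_primes_gt0 rat n)) (ltW (prod_primes_gt0 rat (n + 2)))
  (prod_primes_leif rat _ n_gt1) (prod_primes_leif rat _ n2_gt1).
rewrite [X in X || _]gt_eqF /= in eq_iff; last first.
  by rewrite mulr_gt0 // subr_invsqr_gt0.
split=> [[n_pr n2_pr _] | /invr_inj/eqP].
  by congr (_^-1); apply/eqP; rewrite eq_iff n_pr.
by rewrite eq_iff => /andP[].
Qed.
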